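(* Let $n\geq 4$ be an integer and let $a,b$ be non-zero rational numbers. Then the system of Diophantine equations \[ \sigma_{1}(x_{1},\ldots,x_{n})=a,\qquad \sigma_{n}(x_{1},\ldots,x_{n})=b \] has infinitely many rational parametric solutions depending on $n-3$ free parameters; that is, there are infinitely many distinct $n$-tuples $(x_1,\ldots,x_n)$ of rational functions in $n-3$ independent indeterminates over $\mathbb{Q}$ which satisfy the system identically.
   Context: For $1\leq i\leq n$, $\sigma_{i}(x_{1},\ldots,x_{n})=\sum_{1\leq k_{1}<k_{2}<\cdots<k_{i}\leq n}x_{k_{1}}\cdots x_{k_{i}}$ denotes the $i$-th elementary symmetric polynomial; in particular $\sigma_1$ is the sum and $\sigma_n$ the product of the variables. *)

(* Defs.v *)
From HB Require Import structures.
From mathcomp Require Import all_boot all_order all_algebra.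
From mathcomp Require Export classical_sets cardinality.
From mathcomp Require Export mpoly.

Set Implicit Arguments.
Unset Strict Implicit.
Unset Printing Implicit Defensive.

Import GRing.Theory.
Local Open Scope ring_scope.

(** The field Q(t_0, ..., t_(m-1)) of rational functions. *)
Notation ratfun m := {fraction {mpoly rat[m]}}.

(* [ratr] is not used here because the library makes it a ring morphism only
   into a [numFieldType]. *)
Definition ratfunC (m : nat) (c : rat) : ratfun m := tofrac (mpolyC m c).

Definition elem_sym (m n k : nat) (x : n.-tuple (ratfun m)) : ratfun m :=
  (mesym n (ratfun m) k).@[tnth x].

Definition alg_independent (m r : nat) (y : 'I_r -> ratfun m) : Prop :=
  forall p : {mpoly rat[r]}, mmap (@ratfunC m) y p = 0 -> p = 0.

(** The coordinates of [x] generate a field of transcendence degree [m] over Q,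
    i.e. (as this degree is at most [m]) some [m] of them are algebraically
    independent.  This excludes tuples, such as constant ones, in which the
    [m] indeterminates are not genuinely free parameters. *)
Definition depends_on_free_parameters (m n : nat) (x : n.-tuple (ratfun m)) :
    Prop :=
  exists s : 'I_m -> 'I_n, alg_independent (fun j => tnth x (s j)).

Definition parametric_solution (m n : nat) (a b : rat)
    (x : n.-tuple (ratfun m)) : Prop :=
  [/\ elem_sym 1 x = ratfunC m a,
      elem_sym n x = ratfunC m b
    & depends_on_free_parameters x].

(* Main.v *)
(** Put [A = a - t_1 - ... - t_(n-4)] and [B = b / (t_1 ... t_(n-4))].  It
    suffices to solve [x_1 + x_2 + x_3 + x_4 = A], [x_1 x_2 x_3 x_4 = B].
    Writing [x_2 = y] and [x_1 = r y], the numbers [x_3] and [x_4] are rational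
    iff [v^2 = y^2 (A - (1 + r) y)^2 - 4 B / r] has a rational solution [v].
    For [r = - B / s^2] this genus 1 curve has the (degenerate) point
    [(0, 2 s)]; the parabola [v = (1 + r) y^2 + 2 s] is tangent to the curve
    there and passes through a point at infinity, so it meets the curve in one
    further point, at [y = (A^2 - 4 s (1 + r)) / (2 A (1 + r))].  As a
    function of [s], [y] is a quotient of a cubic by a quadratic, hence
    transcendental over Q(t_1, ..., t_(n-4)).  Taking [s] to be the last
    indeterminate shifted by [k = 0, 1, 2, ...] gives infinitely many
    solutions: [s] can be read off as [(x_3 - A / 2) y]. *)

Require Import Defs.
From mathcomp Require Import all_boot all_order all_algebra.
From mathcomp Require Import ring zify.
Import GRing.Theory.
Local Open Scope ring_scope.
Local Open Scope classical_set_scope.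

Local Notation widen := (widen_ord (leqnSn _)).

(** * Polynomials viewed as univariate in the last indeterminate *)

Lemma mpoly_rmorph_ext (n : nat) (R : nzRingType) (S : nzRingType)
    (f g : {rmorphism {mpoly R[n]} -> S}) :
  (forall c, f c%:MP = g c%:MP) -> (forall i, f 'X_i = g 'X_i) -> f =1 g.
Proof.
move=> fgC fgX p; rewrite [p]mpolyE !raddf_sum; apply: eq_bigr => m _.
rewrite -mul_mpolyC /= !rmorphM fgC mpolyXE_id !rmorph_prod; congr (_ * _).
by apply: eq_bigr => i _; rewrite !rmorphXn /= fgX.
Qed.

Lemma muni_mpolyX_widen (n : nat) (R : nzRingType) (i : 'I_n) :
  muni ('X_(widen i) : {mpoly R[n.+1]}) = ('X_i)%:P.
Proof.
rewrite muniE msuppX big_seq1 mcoeffX eqxx scale1r mnm1E.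
rewrite -val_eqE /= ltn_eqF // expr0 -alg_polyC; congr ('X_[_] *: _).
by apply/mnmP => j; rewrite !mnmE.
Qed.

Lemma muni_mpolyX_max (n : nat) (R : nzRingType) :
  muni ('X_ord_max : {mpoly R[n.+1]}) = 'X.
Proof.
rewrite muniE msuppX big_seq1 mcoeffX eqxx scale1r mnm1E eqxx expr1.
rewrite [X in 'X_[X]](_ : _ = 0%MM) ?mpolyX0 ?scale1r //.
by apply/mnmP => j; rewrite !mnmE -val_eqE /= gtn_eqF.
Qed.

Lemma mwidenX1 (n : nat) (R : nzRingType) (i : 'I_n) :
  mwiden ('X_i : {mpoly R[n]}) = 'X_(widen i).
Proof. by rewrite mwidenX mnmwiden1. Qed.

Lemma muni_mwiden (n : nat) (R : nzRingType) (p : {mpoly R[n]}) :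
  muni (mwiden p) = p%:P.
Proof.
rewrite -[LHS]/((@muni n R \o @mwiden n R) p).
apply: (mpoly_rmorph_ext n R _ (@muni n R \o @mwiden n R) polyC) => [c|i] /=.
  by rewrite mwidenC muniC.
by rewrite mwidenX1 muni_mpolyX_widen.
Qed.

(** Both sides are ring morphisms in [p] that agree on constants and on indeterminates. With [f] the
    identity this recovers [p] from [muni p]. *)
Lemma horner_muni (n : nat) (R : comNzRingType) (S : comNzRingType)
    (f : {rmorphism {mpoly R[n.+1]} -> S}) (p : {mpoly R[n.+1]}) :
  (map_poly (f \o @mwiden n R) (muni p)).[f 'X_ord_max] = f p.
Proof.
pose ev := horner_eval (f 'X_ord_max) \o map_poly (f \o @mwiden n R) \o @muni n R.
rewrite -[LHS]/(ev p).
apply: (mpoly_rmorph_ext n.+1 R _ ev f) => [c|i] /=.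
  by rewrite /horner_eval muniC map_polyC hornerC /= mwidenC.
rewrite /horner_eval.
have [j ->|->] := unliftP ord_max i.
  have -> : lift ord_max j = widen j by apply: val_inj; exact: lift_max.
  by rewrite muni_mpolyX_widen map_polyC hornerC /= mwidenX1.
by rewrite muni_mpolyX_max map_polyX hornerX.
Qed.

Lemma muni_inj (n : nat) (R : comNzRingType) : injective (@muni n R).
Proof.
move=> p q pq; have := horner_muni n R _ idfun q.
by rewrite -pq horner_muni.
Qed.

(** * Transcendence of a quotient whose numerator has the larger degree *)

(** The term [i = d] has strictly larger degree than all others, since trading a factor [u] for [v]
    lowers the degree; hence it cannot cancel. *)
Lemma homogenization_neq0 (R : idomainType) (P u v : {poly R}) (d : nat) :
  size P = d.+1 -> v != 0 -> (size v < size u)%N ->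
  \sum_(i < d.+1) (P`_i)%:P * u ^+ i * v ^+ (d - i) != 0.
Proof.
move=> szP v0 vu; have u0 : u != 0 by rewrite -size_poly_gt0 (leq_ltn_trans _ vu).
have szX (w : {poly R}) j : w != 0 -> size (w ^+ j) = ((size w).-1 * j).+1.
  by move=> w0; rewrite -size_exp prednK // size_poly_gt0 expf_neq0.
have sz i : size (u ^+ i * v ^+ (d - i)) =
    ((size u).-1 * i + (size v).-1 * (d - i)).+1.
  by rewrite size_mul ?expf_neq0 // !szX // addSn addnS.
rewrite big_ord_recr /=.
have ld : P`_d != 0.
  by rewrite -[d]/d.+1.-1 -szP -lead_coefE lead_coef_eq0 -size_poly_gt0 szP.
have szd : size ((P`_d)%:P * u ^+ d * v ^+ (d - d)) = ((size u).-1 * d).+1.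
  by rewrite -mulrA mul_polyC size_scale // sz subnn muln0 addn0.
rewrite -size_poly_gt0 addrC size_polyDl szd // ltnS.
apply: (leq_trans (size_sum _ _ _)); apply/bigmax_leqP => i _.
rewrite -mulrA mul_polyC; apply: (leq_trans (size_scale_leq _ _)); rewrite sz.
have := ltn_ord i; have : (0 < size v)%N by rewrite size_poly_gt0.
move: vu; move: (size u) (size v) (nat_of_ord i) => [|x] [|z] // j.
(* Here [x] and [z] are the degrees of [u] and [v]; the term falls short of the top degree by
   [(x - z) * (d - j) > 0]. *)
by rewrite ltnS /= => zx _ jd; nia.
Qed.

Lemma horner_fraction (F : fieldType) (P : {poly F}) (u v : F) (d : nat) :
  v != 0 -> (size P <= d.+1)%N ->
  v ^+ d * P.[u / v] = \sum_(i < d.+1) P`_i * u ^+ i * v ^+ (d - i).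
Proof.
move=> v0 szP; rewrite (horner_coef_wide _ szP) mulr_sumr.
apply: eq_bigr => i _; rewrite exprMn exprVn mulrCA -mulrA; congr (_ * _).
rewrite mulrCA -expfB_cond // (negPf v0) /=; exact: ltn_ord i.
Qed.

(** A relation [p], read as a polynomial in its last variable, would vanish at [N / D]; clearing
    denominators contradicts [homogenization_neq0]. *)
Lemma alg_independent_last (m : nat) (N D : {mpoly rat[m.+1]}) :
  D != 0 -> (size (muni D) < size (muni N))%N ->
  alg_independent (fun i : 'I_m.+1 =>
    if i == ord_max then tofrac N / tofrac D else tofrac 'X_i).
Proof.
move=> D0 szDN p; set y := tofrac N / tofrac D.
pose h := @tofrac _ \o @mwiden m rat.
pose ev := horner_eval y \o map_poly h \o @muni m rat.
pose w (i : 'I_m.+1) := if i == ord_max then y else tofrac 'X_i.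
pose c := @tofrac _ \o @mpolyC m.+1 rat.
have -> : mmap (@ratfunC m.+1) w p = ev p.
  rewrite -[LHS]/(mmap c w p).
  apply: (mpoly_rmorph_ext m.+1 rat _ (mmap c w) ev) => [z|i] /=.
    by rewrite mmapC /horner_eval muniC map_polyC hornerC /= mwidenC.
  rewrite mmapX mmap1U /w /horner_eval.
  have [j ->|->] := unliftP ord_max i.
    have -> : lift ord_max j = widen j by apply: val_inj; exact: lift_max.
    rewrite muni_mpolyX_widen map_polyC hornerC /= mwidenX1.
    by rewrite -val_eqE /= ltn_eqF.
  by rewrite eqxx muni_mpolyX_max map_polyX hornerX.
move=> evp0; apply: muni_inj; rewrite muni0; apply/eqP/negPn/negP => P0.
have D0' : tofrac D != 0 by rewrite tofrac_eq0.
have mD0 : muni D != 0 by rewrite -(muni0 m rat) (inj_eq (@muni_inj _ _)).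
move: P0; rewrite -size_poly_gt0; case szP: (size (muni p)) => [|d] // _.
have /negP := homogenization_neq0 _ _ _ _ _ szP mD0 szDN; apply=> {szDN}.
(* [muni] sends [T] to the nonzero homogenization, while [tofrac] sends it to [D ^ d] times the
   value of the relation, which is zero. *)
pose T : {mpoly rat[m.+1]} :=
  \sum_(i < d.+1) mwiden (muni p)`_i * N ^+ i * D ^+ (d - i).
suff T0 : T = 0.
  rewrite [X in X == _](_ : _ = muni T); first by rewrite T0 muni0.
  rewrite raddf_sum; apply: eq_bigr => i _.
  by rewrite /= !rmorphM !rmorphXn /= muni_mwiden.
apply/eqP; rewrite -tofrac_eq0 -(mulr0 (tofrac D ^+ d)) -evp0; apply/eqP.
rewrite /ev /= /horner_eval (horner_fraction _ _ _ _ d D0'); last first.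
  by rewrite -szP size_poly.
rewrite [LHS]raddf_sum; apply: eq_bigr => i _ /=.
rewrite !rmorphM !rmorphXn /= coef_map_id0 //.
by rewrite /h /= mwiden0 tofrac0.
Qed.

(** * The identities behind the four-variable system *)

Lemma four_term_sum (F : fieldType) (A y z r S : F) :
  2 != 0 :> F ->
  r * y + (A / 2 + z + (A / 2 - (1 + r) * y - z + (S + y))) = A + S.
Proof. by move=> n2; field. Qed.

(** [T] stands for the product of the remaining parameters, so [r] is [- B / s ^ 2] with
    [B = b / T]. From [N != 0] comes [y != 0], which makes [s / y] meaningful. *)
Lemma four_term_product (F : fieldType) (A T b s D N : F) :
  D = 2 * A * (T * s ^+ 2 - b) ->
  N = s * (A ^+ 2 * T * s - 4 * (T * s ^+ 2 - b)) ->
  T != 0 -> s != 0 -> D != 0 -> N != 0 ->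
  let y := N / D in
  let r := - (b / (T * s ^+ 2)) in
  r * y * ((A / 2 + s / y) * ((A / 2 - (1 + r) * y - s / y) * (T * y))) = b.
Proof.
move=> -> -> T0 s0.
rewrite !mulf_eq0 !negb_or => /andP[/andP[n2 A0] d0] /andP[_ n0] /=.
by field; rewrite n2 A0 s0 T0 d0 n0.
Qed.

Lemma meval_mesym1 (R : comNzRingType) (n : nat) (v : 'I_n -> R) :
  (mesym n R 1).@[v] = \sum_(i < n) v i.
Proof. by rewrite mesym1E raddf_sum; apply: eq_bigr => i _; rewrite /= mevalXU. Qed.

Lemma meval_mesymnn (R : comNzRingType) (n : nat) (v : 'I_n -> R) :
  (mesym n R n).@[v] = \prod_(i < n) v i.
Proof.
by rewrite mesymnnE rmorph_prod; apply: eq_bigr => i _; rewrite /= mevalXU.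
Qed.

(** * Degrees of the denominator and numerator of [y] *)

Lemma size_quadratic (R : idomainType) (t c : R) (s : {poly R}) :
  t != 0 -> size s = 2%N -> size (t%:P * s ^+ 2 - c%:P) = 3%N.
Proof.
move=> t0 szs; have sz : size (t%:P * s ^+ 2) = 3%N.
  rewrite mul_polyC size_scale // expr2 size_mul ?szs //.
    by rewrite -size_poly_eq0 szs.
  by rewrite -size_poly_eq0 szs.
by rewrite size_polyDl sz // size_polyN (leq_ltn_trans (size_polyC_leq1 _)).
Qed.

Lemma size_cubic (R : idomainType) (e t c q : R) (s : {poly R}) :
  t != 0 -> q != 0 -> size s = 2%N ->
  size (s * (e%:P * s - q%:P * (t%:P * s ^+ 2 - c%:P))) = 4%N.
Proof.
move=> t0 q0 szs.
have sz : size (- (q%:P * (t%:P * s ^+ 2 - c%:P))) = 3%N.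
  by rewrite size_polyN mul_polyC size_scale // size_quadratic.
have sz' : size (e%:P * s - q%:P * (t%:P * s ^+ 2 - c%:P)) = 3%N.
  rewrite addrC size_polyDl sz // mul_polyC.
  by rewrite (leq_ltn_trans (size_scale_leq _ _)) // szs.
by rewrite size_mul ?szs ?sz' // -size_poly_eq0 ?szs ?sz'.
Qed.

(** * The family of solutions indexed by the shift [k] *)

Section Family.
Variables (m : nat) (a b : rat).
Hypothesis a_neq0 : a != 0.

Let A : {mpoly rat[m]} := a%:MP - \sum_(i < m) 'X_i.
Let T : {mpoly rat[m]} := \prod_(i < m) 'X_i.

Let A_neq0 : A != 0.
Proof.
apply: contra_neq a_neq0 => /(congr1 (meval (fun=> 0))).
rewrite meval0 mevalB mevalC (raddf_sum (meval _)) big1 ?subr0 // => i _.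
by rewrite /= mevalXU.
Qed.

Let T_neq0 : T != 0.
Proof.
apply/eqP => /(congr1 (meval (fun=> 1))) /eqP.
by rewrite meval0 rmorph_prod big1 ?oner_eq0 // => i _; rewrite /= mevalXU.
Qed.

Variable k : nat.

Let s : {mpoly rat[m.+1]} := 'X_ord_max + k%:R.
Let Aw := mwiden A.
Let Tw := mwiden T.
(* [N / D] is [y] after multiplication of numerator and denominator by
   [s ^+ 2 * Tw]. *)
Let D := 2 * Aw * (Tw * s ^+ 2 - b%:MP).
Let N := s * (Aw ^+ 2 * Tw * s - 4 * (Tw * s ^+ 2 - b%:MP)).

Let size_s : size (muni s) = 2%N.
Proof.
by rewrite rmorphD rmorph_nat /= muni_mpolyX_max -polyC_natr size_XaddC.
Qed.

Let natr_neq0 n : (n.+1%:R : {mpoly rat[m]}) != 0.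
Proof. by rewrite -mpolyC_nat mpolyC_eq0 Num.Theory.pnatr_eq0. Qed.

Let muni_quadratic :
  muni (Tw * s ^+ 2 - b%:MP) = T%:P * muni s ^+ 2 - (b%:MP)%:P.
Proof. by rewrite muniB muniM (rmorphXn (@muni m rat)) muni_mwiden muniC. Qed.

Let size_D : size (muni D) = 3%N.
Proof.
rewrite !muniM muni_quadratic muni_mwiden (rmorph_nat (@muni m rat)).
rewrite -polyC_natr -polyCM mul_polyC size_scale; first exact: size_quadratic.
exact: mulf_neq0 (natr_neq0 1) A_neq0.
Qed.

Let size_N : size (muni N) = 4%N.
Proof.
rewrite muniM muniB !muniM muni_quadratic !muni_mwiden.
rewrite (rmorph_nat (@muni m rat)) -polyC_natr -!polyCM.
(* [natr_neq0] is stated for successors: the index 3 refers to the coefficient 4. *)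
exact: size_cubic T_neq0 (natr_neq0 3) size_s.
Qed.

Let neq0_size (p : {mpoly rat[m.+1]}) : (0 < size (muni p))%N -> p != 0.
Proof. by apply: contraTneq => ->; rewrite muni0 size_poly0. Qed.

Let s_neq0 : s != 0. Proof. by apply: neq0_size; rewrite size_s. Qed.
Let D_neq0 : D != 0. Proof. by apply: neq0_size; rewrite size_D. Qed.
Let N_neq0 : N != 0. Proof. by apply: neq0_size; rewrite size_N. Qed.

Let sF := tofrac s.
Let AF := tofrac Aw.
Let TF := tofrac Tw.
Let y := tofrac N / tofrac D.
Let r := - (ratfunC m.+1 b / (TF * sF ^+ 2)).

(** These coordinates witness the dependence on the parameters: [y] takes the slot of the last
    indeterminate, which is not itself a coordinate. *)
Definition solution_free (i : 'I_m.+1) : ratfun m.+1 :=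
  if i == ord_max then y else tofrac 'X_i.

(** The order is [x_1, x_3, x_4, t_1, ..., t_m, x_2], so that [rshift 3] selects the independent
    coordinates. *)
Definition solution : m.+4.-tuple (ratfun m.+1) :=
  [tuple of [:: r * y, AF / 2 + sF / y, AF / 2 - (1 + r) * y - sF / y
             & [tuple solution_free i | i < m.+1]]].

Let solution_free_widen (i : 'I_m) : solution_free (widen i) = tofrac (mwiden 'X_i).
Proof. by rewrite mwidenX1 /solution_free -val_eqE /= ltn_eqF. Qed.

Let two_neq0 : (2 : ratfun m.+1) != 0.
Proof.
rewrite -(rmorph_nat (@tofrac {mpoly rat[m.+1]})) tofrac_eq0.
by rewrite -mpolyC_nat mpolyC_eq0 Num.Theory.pnatr_eq0.
Qed.

Lemma solution_sum : elem_sym 1 solution = ratfunC m.+1 a.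
Proof.
rewrite /elem_sym meval_mesym1 -(big_tuple _ _ solution predT id) /= !big_cons.
rewrite big_map big_enum big_ord_recr /= {2}/solution_free eqxx.
under eq_bigr do rewrite solution_free_widen.
have -> : ratfunC m.+1 a = AF + \sum_(i < m) tofrac (mwiden 'X_i).
  rewrite /AF /Aw /A /ratfunC mwidenB mwidenC rmorphB (raddf_sum (@mwiden m rat)).
  by rewrite (raddf_sum (@tofrac _)) /= subrK.
exact: four_term_sum.
Qed.

Lemma solution_prod : elem_sym m.+4 solution = ratfunC m.+1 b.
Proof.
rewrite /elem_sym meval_mesymnn -(big_tuple _ _ solution predT id) /= !big_cons.
rewrite big_map big_enum big_ord_recr /= {2}/solution_free eqxx.
under eq_bigr do rewrite solution_free_widen.
have -> : \prod_(i < m) tofrac (mwiden 'X_i) = TF.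
  by rewrite /TF /Tw /T (rmorph_prod (@mwiden m rat)) (rmorph_prod (@tofrac _)).
apply: four_term_product; rewrite ?tofrac_eq0.
- by rewrite /D !(tofracM, tofracB, tofracXn) (rmorph_nat (@tofrac _)).
- by rewrite /N !(tofracM, tofracB, tofracXn) (rmorph_nat (@tofrac _)).
- by rewrite neq0_size // muni_mwiden size_polyC T_neq0.
- exact: s_neq0.
- exact: D_neq0.
- exact: N_neq0.
Qed.

Lemma solution_free_independent : alg_independent solution_free.
Proof.
have szDN : (size (muni D) < size (muni N))%N.
  (* [rewrite size_D] does not terminate here: it tries to unify [muni D] with
     [muni N] by computation. *)
  have lt34 (u v : nat) : u = 3%N -> v = 4%N -> (u < v)%N by move=> -> ->.
  exact: lt34 size_D size_N.
exact (alg_independent_last m N D D_neq0 szDN).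
Qed.

Lemma tnth_solution_free (i : 'I_m.+1) :
  tnth solution (rshift 3 i) = solution_free i.
Proof.
rewrite (tnth_nth 0) /= add0n (nth_map ord0) ?size_enum_ord //.
by rewrite nth_ord_enum.
Qed.

Lemma solution_parametric : parametric_solution a b solution.
Proof.
split; [exact: solution_sum | exact: solution_prod | exists (@rshift 3 m.+1)].
rewrite (_ : (fun j => _) = solution_free); first exact: solution_free_independent.
by apply: boolp.funext => j; rewrite tnth_solution_free.
Qed.

Lemma solution_last_neq0 : tnth solution (rshift 3 ord_max) != 0.
Proof.
rewrite tnth_solution_free /solution_free eqxx.
apply: mulf_neq0; first by rewrite tofrac_eq0 N_neq0.
by rewrite invr_eq0 tofrac_eq0 D_neq0.
Qed.

Lemma solution_parameter :
  (tnth solution (lift ord0 ord0) - AF / 2) * tnth solution (rshift 3 ord_max) =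
  tofrac ('X_ord_max + k%:R).
Proof.
have := solution_last_neq0; rewrite tnth_solution_free /solution_free eqxx => y0.
by rewrite (tnth_nth 0) /= addrAC subrr add0r divfK.
Qed.

End Family.

(** * Infinitude of the family *)

(** As [A] does not involve [k], equal tuples yield equal values of [s], that is, of the last
    indeterminate plus [k]. *)
Lemma solution_inj (m : nat) (a b : rat) : a != 0 -> injective (solution m a b).
Proof.
move=> a_neq0 k l kl; have := solution_parameter m a b a_neq0 k.
rewrite kl solution_parameter // => /eqP; rewrite tofrac_eq => /eqP /addrI /eqP.
by rewrite -!mpolyC_nat mpolyC_eq Num.Theory.eqr_nat => /eqP.
Qed.

Theorem theorem1 (n : nat) (hn : (4 <= n)%N) (a b : rat)
    (ha : a != 0) (hb : b != 0) :
  infinite_set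
    [set x : n.-tuple (ratfun (n - 3)%N) | parametric_solution a b x].
Proof.
case: n hn => [|[|[|[|m]]]] // _.
(* Were the solution set finite, so would be its preimage under the injective [solution m a b],
   which is all of [nat]. *)
move=> fin; apply: infinite_nat.
have sub : [set: nat] `<=`
    solution m a b @^-1` [set x | parametric_solution a b x].
  by move=> k _; exact: solution_parametric.
apply: (sub_finite_set sub); apply: finite_preimage fin => k l _ _.
exact: solution_inj.
Qed.
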